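(* Let $(\Theta,\mathcal{A})$ be a measurable space, let $\mu'$ be a probability measure on $(\Theta,\mathcal{A})$, let $n\in\mathbb{N}$, and let $\mathbf{C},\widehat{\mathbf{C}}:\Theta\to\mathrm{SPSD}(n)$ be measurable functions such that $\mathbf{C}(\theta)-\widehat{\mathbf{C}}(\theta)$ is symmetric positive semidefinite for $\mu'$-almost every $\theta\in\Theta$. Let $\mu:=\mu'\mathrm{N}(0,\mathbf{C})$ and $\widehat{\mu}:=\mu'\mathrm{N}(0,\widehat{\mathbf{C}})$, and assume that $\int_{\mathbb{R}^n}\|X\|_2^2\,\mu(\mathrm{d}X)<\infty$. Then $$\mathrm{W}_2(\mu,\widehat{\mu})\le\left(\int_\Theta\operatorname{trace}\bigl(\mathbf{C}(\theta)-\widehat{\mathbf{C}}(\theta)\bigr)\,\mu'(\mathrm{d}\theta)\right)^{1/2}.$$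
   Context: $\mathrm{SPSD}(n)$ denotes the set of symmetric positive semidefinite matrices in $\mathbb{R}^{n\times n}$. $\mathrm{N}(0,C)$ denotes the (possibly degenerate) Gaussian probability measure on $\mathbb{R}^n$ with its Borel $\sigma$-algebra $\mathcal{B}\mathbb{R}^n$, with mean $0$ and covariance matrix $C\in\mathrm{SPSD}(n)$. For a measurable map $\mathbf{C}:\Theta\to\mathrm{SPSD}(n)$, the hierarchical measure $\mu'\mathrm{N}(0,\mathbf{C})$ is the probability measure on $(\mathbb{R}^n,\mathcal{B}\mathbb{R}^n)$ given by $$\mu'\mathrm{N}(0,\mathbf{C})(B):=\int_\Theta \mathrm{N}(0,\mathbf{C}(\theta))(B)\,\mu'(\mathrm{d}\theta)\qquad(B\in\mathcal{B}\mathbb{R}^n).$$ For probability measures $\nu,\widehat{\nu}$ on $(\mathbb{R}^n,\mathcal{B}\mathbb{R}^n)$, let $\mathrm{Coup}(\nu,\widehat{\nu})$ be the set of probability measures $H$ on $(\mathbb{R}^{2n},\mathcal{B}\mathbb{R}^{2n})$ with $H(B\times\mathbb{R}^n)=\nu(B)$ and $H(\mathbb{R}^n\times B)=\widehat{\nu}(B)$ for all $B\in\mathcal{B}\mathbb{R}^n$. The Wasserstein-2 distance is $$\mathrm{W}_2(\nu,\widehat{\nu}):=\left(\inf_{H\in\mathrm{Coup}(\nu,\widehat{\nu})}\int_{\mathbb{R}^{2n}}\|X_1-X_2\|_2^2\,H(\mathrm{d}X_1,\mathrm{d}X_2)\right)^{1/2},$$ where $\|\cdot\|_2$ is the Euclidean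 norm. *)

(* Defs.v *)
From HB Require Import structures.
From mathcomp Require Import all_boot all_order all_algebra.
From mathcomp Require Import all_classical all_reals all_analysis.
From mathcomp Require Import measurable_realfun ring lra.

Set Implicit Arguments.
Unset Strict Implicit.
Unset Printing Implicit Defensive.

Import Order.TTheory GRing.Theory Num.Theory.
Import numFieldNormedType.Exports.

Local Open Scope classical_set_scope.
Local Open Scope ring_scope.

(* The Borel sigma-algebra on R^(m x n), generated by the open sets. *)
HB.instance Definition _ (R : realType) (m n : nat) :=
  @isMeasurable.Build (sigma_display (@open 'M[R]_(m, n))) 'M[R]_(m, n)
    <<s @open 'M[R]_(m, n) >>
    (@sigma_algebra0 _ setT _) (@sigma_algebraC _ _)
    (@sigma_algebra_bigcup _ setT _).

Section borel_matrix.
Context {R : realType}.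

Lemma open_measurable_mx m n (U : set 'M[R]_(m, n)) : open U -> measurable U.
Proof. by move=> oU; exact: sub_sigma_algebra. Qed.

Lemma closed_measurable_mx m n (F : set 'M[R]_(m, n)) :
  closed F -> measurable F.
Proof.
move=> cF; rewrite -(setCK F); apply: measurableC.
by apply: open_measurable_mx; rewrite openC.
Qed.

Lemma measurable_coord m n i j :
  measurable_fun setT (fun A : 'M[R]_(m, n) => A i j).
Proof.
apply: (measurability _ (RGenOpens.measurableE R)) => _ [_ [a [b ->] <-]].
rewrite setTI; apply: open_measurable_mx.
apply: open_comp; last exact: interval_open.
by move=> A _; exact: coord_continuous.
Qed.

Lemma mx_ratball m n (U : set 'M[R]_(m, n)) (A : 'M[R]_(m, n)) :
  open U -> U A -> exists q : 'M[rat]_(m, n), exists k : nat,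
    ball (map_mx ratr q : 'M[R]_(m, n)) k.+1%:R^-1 `<=` U /\
    ball (map_mx ratr q : 'M[R]_(m, n)) k.+1%:R^-1 A.
Proof.
move=> oU UA.
have /nbhs_ballP[e /= e0 eU] : nbhs A U by apply: open_nbhs_nbhs.
have [k ke] : exists k : nat, k.+1%:R^-1 < e / 2 :> R.
  have e2 : 0 < e / 2 by rewrite divr_gt0.
  exists (Num.truncn (e / 2)^-1); rewrite -[ltRHS]invrK ltf_pV2 ?posrE ?invr_gt0//.
  exact: truncnS_gt.
have Hq i j : exists q : rat, `|A i j - ratr q| < k.+1%:R^-1 :> R.
  have [|q] := @rat_in_itvoo R (A i j - k.+1%:R^-1) (A i j + k.+1%:R^-1).
    by rewrite ltrBlDr -addrA ltrDl addr_gt0// invr_gt0.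
  by rewrite in_itv/= -ltr_distlC; exists q.
pose q := \matrix_(i, j) projT1 (cid (Hq i j)).
have kq : ball (map_mx ratr q : 'M[R]_(m, n)) k.+1%:R^-1 A.
  split; first by rewrite invr_gt0.
  by move=> i j; rewrite /ball/= !mxE distrC; case: cid.
exists q, k; split => // B kB; apply: eU.
rewrite (splitr e).
apply: (@ball_triangle _ _ (map_mx ratr q : 'M[R]_(m, n)) A B).
  by apply/ball_sym; apply: le_ball kq; exact/ltW.
by apply: le_ball kB; exact/ltW.
Qed.

Lemma measurable_fun_mx d (T : measurableType d) m n (f : T -> 'M[R]_(m, n)) :
  (forall i j, measurable_fun setT (fun x => f x i j)) ->
  measurable_fun setT f.
Proof.
move=> mf; apply: (@measurability _ _ _ _ setT f (@open 'M[R]_(m, n))) => //.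
move=> _ [U oU <-]; rewrite setTI.
pose B (p : 'M[rat]_(m, n) * nat) : set 'M[R]_(m, n) :=
  ball (map_mx ratr p.1 : 'M[R]_(m, n)) p.2.+1%:R^-1.
have -> : f @^-1` U = \bigcup_(p in [set p | B p `<=` U]) f @^-1` B p.
  apply/seteqP; split => [x Ux|x [p pU]]; last exact: pU.
  by have [q [k [qkU qkx]]] := mx_ratball oU Ux; exists (q, k).
rewrite bigcup_mkcond; apply: countable_bigcupT_measurable => [|p].
  exact: countableP.
case: ifPn => // _.
have -> : f @^-1` B p = \bigcap_(ij in [set: 'I_m * 'I_n])
    (fun x => f x ij.1 ij.2) @^-1` ball (ratr (p.1 ij.1 ij.2) : R) p.2.+1%:R^-1.
  apply/seteqP; split => x /=.
    by move=> [_ H] [i j] _; have := H i j; rewrite mxE.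
  move=> H; split; first by rewrite invr_gt0.
  by move=> i j; rewrite mxE; exact: (H (i, j)).
apply: fin_bigcap_measurable => // -[i j] _ /=.
rewrite -[X in measurable X]setTI; apply: mf => //.
exact: measurable_ball.
Qed.

Lemma continuous_measurable_fun_mx m n p q (f : 'M[R]_(m, n) -> 'M[R]_(p, q)) :
  continuous f -> measurable_fun setT f.
Proof.
move=> cf; apply: (@measurability _ _ _ _ setT f (@open 'M[R]_(p, q))) => //.
move=> _ [U oU <-]; rewrite setTI; apply: open_measurable_mx.
by apply: open_comp => // A _; exact: cf.
Qed.

Lemma measurable_fun_mulmx d (T : measurableType d) m n p
    (f : T -> 'M[R]_(m, n)) (g : T -> 'M[R]_(n, p)) :
  measurable_fun setT f -> measurable_fun setT g ->
  measurable_fun setT (fun x => f x *m g x).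
Proof.
move=> mf mg; apply: measurable_fun_mx => i j.
under eq_fun do rewrite mxE.
apply: measurable_sum => k; apply: measurable_funM.
  exact: (measurableT_comp (measurable_coord i k) mf).
exact: (measurableT_comp (measurable_coord k j) mg).
Qed.

End borel_matrix.

Section spsd.
Context {R : realType}.

Definition SPSD n : set 'M[R]_n :=
  [set A | A^T = A /\ forall x : 'cV[R]_n, 0 <= (x^T *m A *m x) 0 0].

Lemma mulmx_tr_col m (v : 'cV[R]_m) : (v^T *m v) 0 0 = \sum_i v i 0 ^+ 2.
Proof. by rewrite mxE; apply: eq_bigr => i _; rewrite mxE expr2. Qed.

Lemma mulmx_tr_col_ge0 m (v : 'cV[R]_m) : 0 <= (v^T *m v) 0 0.
Proof. by rewrite mulmx_tr_col sumr_ge0// => i _; exact: sqr_ge0. Qed.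

Lemma mulmx_tr_col_eq0 m (v : 'cV[R]_m) : (v^T *m v) 0 0 = 0 -> v = 0.
Proof.
move/eqP; rewrite mulmx_tr_col psumr_eq0; last by move=> i _; exact: sqr_ge0.
move=> /allP v0; apply/matrixP => i j; rewrite (ord1 j) mxE.
by have := v0 i; rewrite mem_index_enum sqrf_eq0 => /(_ isT)/eqP.
Qed.

Lemma SPSD_quad_eq0 n (A : 'M[R]_n) (v : 'cV[R]_n) :
  SPSD A -> (v^T *m A *m v) 0 0 = 0 -> A *m v = 0.
Proof.
move=> [At A0] v0; apply: mulmx_tr_col_eq0.
set w := A *m v; set b := (w^T *m w) 0 0; set c := (w^T *m A *m w) 0 0.
have b0 : 0 <= b by exact: mulmx_tr_col_ge0.
have c0 : 0 <= c by exact: A0.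
have wAv : (w^T *m A *m v) 0 0 = b by rewrite -mulmxA.
have vAw : (v^T *m A *m w) 0 0 = b by rewrite /b {3}/w trmx_mul At.
have H t : 0 <= t *+ 2 * b + t ^+ 2 * c.
  have := A0 (v + t *: w).
  have -> : (v + t *: w)^T = v^T + t *: w^T by rewrite linearD linearZ.
  rewrite !mulmxDl !mulmxDr -!scalemxAl -!scalemxAr scalerA.
  rewrite mxE [X in X + _]mxE [X in _ + X]mxE v0 [in X in 0 + X + _]mxE vAw.
  rewrite [in X in _ + (X + _)]mxE wAv [in X in _ + (_ + X)]mxE -/c.
  by congr (0 <= _); ring.
apply/eqP; rewrite -/b eq_le b0 andbT leNgt; apply/negP => bgt0.
have c1 : 0 < c + 1 by rewrite ltr_wpDl.
have := H (- b / (c + 1)); apply/negP; rewrite -ltNge.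
have -> : (- b / (c + 1)) *+ 2 * b + (- b / (c + 1)) ^+ 2 * c =
    - (b ^+ 2 * (c + 2) / (c + 1) ^+ 2).
  by field; rewrite gt_eqF.
rewrite oppr_lt0 divr_gt0 ?mulr_gt0 ?exprn_gt0//.
by rewrite ltr_wpDl.
Qed.

Lemma SPSD_tr_eq0 n (A D : 'M[R]_n) : SPSD A -> D^T = D ->
  0 <= \tr (D *m A *m D) /\ (\tr (D *m A *m D) = 0 -> A *m D = 0).
Proof.
move=> sA Dt.
have E i : (D *m A *m D) i i = ((col i D)^T *m A *m col i D) 0 0.
  by rewrite tr_col Dt -!row_mul !colE mulmxA -colE [RHS]mxE [RHS]mxE.
have E0 i : 0 <= (D *m A *m D) i i by rewrite E; exact: sA.2.
split; first by rewrite /mxtrace sumr_ge0.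
move/eqP; rewrite /mxtrace psumr_eq0// => /allP tr0.
apply/matrixP => i j; have := tr0 j; rewrite mem_index_enum => /(_ isT)/eqP.
rewrite E => /(SPSD_quad_eq0 sA) /matrixP/(_ i 0).
by rewrite colE mulmxA -colE !mxE.
Qed.

Lemma SPSD_sqr_inj n (A B : 'M[R]_n) :
  SPSD A -> SPSD B -> A *m A = B *m B -> A = B.
Proof.
move=> sA sB AB; have [D DE] : exists D, D = A - B by exists (A - B).
have Dt : D^T = D by rewrite DE linearB/= sA.1 sB.1.
have [a0 aD] := SPSD_tr_eq0 sA Dt; have [b0 bD] := SPSD_tr_eq0 sB Dt.
have E : (A + B) *m D + D *m (A + B) = 0.
  rewrite DE mulmxDl mulmxBl !mulmxBr !mulmxDr AB.
  move: (A *m B) (B *m A) (B *m B) => X Y Z.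
  by apply/matrixP => i j; rewrite !mxE; ring.
have tr0 : \tr (D *m A *m D) + \tr (D *m B *m D) = 0.
  have T : \tr (D *m (A + B) *m D) = \tr (D *m A *m D) + \tr (D *m B *m D).
    by rewrite mulmxDr mulmxDl mxtraceD.
  have := congr1 (fun X => \tr (D *m X)) E.
  rewrite mulmxDr mxtraceD mulmx0 mxtrace0 [X in _ + X]mxtrace_mulC mulmxA T.
  by move=> /eqP; rewrite -mulr2n mulrn_eq0/= => /eqP.
have AD : A *m D = 0 by apply: aD; lra.
have BD : B *m D = 0 by apply: bD; lra.
have DD : D *m D = 0 by rewrite {1}DE mulmxBl AD BD subrr.
have sI : SPSD (1%:M : 'M[R]_n).
  by split=> [|x]; rewrite ?trmx1// mulmx1; exact: mulmx_tr_col_ge0.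
have [_] := SPSD_tr_eq0 sI Dt; rewrite mulmx1 DD linear0 mul1mx => /(_ erefl).
by rewrite DE => /eqP; rewrite subr_eq0 => /eqP.
Qed.

(* The symmetric positive semidefinite square root, which is unique. *)
Definition sqrtmx n (A : 'M[R]_n) : 'M[R]_n :=
  xget 0 [set S | SPSD S /\ S *m S = A].

Lemma sqrtmxE n (S : 'M[R]_n) : SPSD S -> sqrtmx (S *m S) = S.
Proof.
move=> sS; rewrite /sqrtmx; apply: xget_unique => // T [sT TS].
exact: SPSD_sqr_inj.
Qed.

Lemma sqrtmx_out n (A : 'M[R]_n) :
  (forall S, SPSD S -> S *m S <> A) -> sqrtmx A = 0.
Proof. by move=> nA; apply: xgetPN => S [sS /nA]; exact. Qed.

Lemma continuous_mx (T : topologicalType) m n (f : T -> 'M[R]_(m, n)) :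
  (forall i j, continuous (fun x => f x i j)) -> continuous f.
Proof.
move=> cf x U [P Px PU].
have : \forall y \near x, forall i j, P i j (f y i j).
  by do 2!apply: filter_forall => ?; exact: cf (Px _ _).
by apply: filterS => y Py; exact: PU.
Qed.

Lemma continuous_mulmx (T : topologicalType) m n p
    (f : T -> 'M[R]_(m, n)) (g : T -> 'M[R]_(n, p)) :
  continuous f -> continuous g -> continuous (fun x => f x *m g x).
Proof.
move=> cf cg; apply: continuous_mx => i j.
have -> : (fun x => (f x *m g x) i j) = (fun x => \sum_k f x i k * g x k j).
  by apply/funext => x; rewrite mxE.
apply: continuous_big => [|k _ x]; first exact: add_continuous.
apply: cvgM.
  exact: (continuous_comp (cf x) (@coord_continuous _ _ _ i k (f x))).
exact: (continuous_comp (cg x) (@coord_continuous _ _ _ k j (g x))).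
Qed.

Lemma closed_SPSD n : closed (@SPSD n).
Proof.
have -> : @SPSD n =
    (\bigcap_(ij in [set: 'I_n * 'I_n])
      (fun A : 'M[R]_n => A ij.1 ij.2 - A ij.2 ij.1) @^-1` [set 0]) `&`
    (\bigcap_(x in [set: 'cV[R]_n])
      (fun A : 'M[R]_n => (x^T *m A *m x) 0 0) @^-1` [set y | 0 <= y]).
  apply/seteqP; split => A.
    move=> [At A0]; split => [[i j] _ /=|x _]; last exact: A0.
    by rewrite -{1}At mxE subrr.
  move=> [At A0]; split => [|x]; last exact: A0.
  apply/matrixP => i j; rewrite mxE; apply/eqP; rewrite -subr_eq0; apply/eqP.
  exact: (At (j, i)).
apply: closedI; apply: closed_bigI.
  move=> [i j] _ /=; apply: closed_comp; last exact: closed_eq.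
  move=> A _; apply: (@continuousB _ _ _ (fun A : 'M[R]_n => A i j)
    (fun A : 'M[R]_n => A j i)); exact: coord_continuous.
move=> x _ /=; apply: closed_comp; last exact: closed_ge.
move=> A _; apply: (@continuous_comp _ _ _
  (fun A : 'M[R]_n => x^T *m A *m x) (fun B : 'M[R]_1 => B 0 0)).
  apply: continuous_mulmx => [|B]; last exact: cst_continuous.
  by apply: continuous_mulmx => [B|]; [exact: cst_continuous|move=> ?; exact: cvg_id].
exact: coord_continuous.
Qed.

Lemma compact_box n (r : R) :
  compact [set A : 'M[R]_n | forall i j, A i j \in `[- r, r]].
Proof.
have -> : [set A : 'M[R]_n | forall i j, A i j \in `[- r, r]] =
    vec_mx @` [set v : 'rV[R]_(n * n) | forall i, v ord0 i \in `[- r, r]].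
  apply/seteqP; split => [A rA|_ [v rv <-] i j]; last by rewrite mxE; exact: rv.
  exists (mxvec A); last by rewrite mxvecK.
  by move=> k; case/mxvec_indexP: k => i j; rewrite mxvecE; exact: rA.
apply: continuous_compact.
  apply: continuous_subspaceT; apply: continuous_mx => i j.
  under eq_fun do rewrite mxE.
  exact: coord_continuous.
apply: (@rV_compact _ _ (fun=> `[- r, r]%classic)) => _.
exact: segment_compact.
Qed.

Lemma mx_hausdorff m n : hausdorff_space 'M[R]_(m, n).
Proof. exact: norm_hausdorff. Qed.

Lemma measurable_SPSD_sqr n (F : set 'M[R]_n) : closed F ->
  measurable [set S *m S | S in F `&` @SPSD n].
Proof.
move=> cF.
have -> : [set S *m S | S in F `&` @SPSD n] = \bigcup_(k in [set: nat])
    [set S *m S | S in [set A : 'M[R]_n | forall i j,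
      A i j \in `[- k%:R, k%:R]] `&` (F `&` @SPSD n)].
  apply/seteqP; split => [_ [S FS <-]|_ [k _] [S [_ FS] <-]]; last by exists S.
  pose k := Num.truncn (\sum_i \sum_j `|S i j|).
  exists k.+1 => //; exists S => //; split => // i j.
  rewrite in_itv/= -ler_norml; apply: ltW; apply: le_lt_trans (truncnS_gt _).
  rewrite (bigD1 i)//= (bigD1 j)//= -addrA lerDl addr_ge0// sumr_ge0//.
  by move=> ? _; rewrite sumr_ge0.
apply: bigcupT_measurable => k; apply: closed_measurable_mx.
apply: compact_closed; first exact: mx_hausdorff.
apply: continuous_compact.
  apply: continuous_subspaceT.
  by apply: continuous_mulmx => ?; exact: cvg_id.
apply: compact_closedI; first exact: compact_box.
by apply: closedI => //; exact: closed_SPSD.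
Qed.

Lemma measurable_preimage_sqrtmx n (F : set 'M[R]_n) : closed F ->
  measurable (@sqrtmx n @^-1` F).
Proof.
move=> cF; pose G := [set S *m S | S in setT `&` @SPSD n].
have -> : @sqrtmx n @^-1` F = [set S *m S | S in F `&` @SPSD n] `|`
    (if 0 \in F then ~` G else set0).
  apply/seteqP; split => [A FA|A [[S [FS sS] <-]|]]; last 2 first.
  - by rewrite /preimage/= sqrtmxE.
  - case: ifPn => // /set_mem F0 nG; rewrite /preimage/= sqrtmx_out// => S sS SA.
    by apply: nG; exists S.
  have [[S [_ sS] SA]|nG] := pselect (G A).
    left; exists S => //; split => //.
    by move: FA; rewrite /preimage/= -SA sqrtmxE.
  right; move: FA; rewrite /preimage/= sqrtmx_out.
    by move=> F0; rewrite ifT ?inE.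
  by move=> S sS SA; apply: nG; exists S.
apply: measurableU; first exact: measurable_SPSD_sqr.
case: ifPn => // _; apply: measurableC; apply: measurable_SPSD_sqr.
exact: closedT.
Qed.

Lemma measurable_sqrtmx n : measurable_fun setT (@sqrtmx n).
Proof.
apply: (@measurability _ _ _ _ setT (@sqrtmx n) (@open 'M[R]_n)) => //.
move=> _ [U oU <-]; rewrite setTI -[U]setCK preimage_setC; apply: measurableC.
exact: (@measurable_preimage_sqrtmx n (~` U) (open_closedC oU)).
Qed.

End spsd.

Section gaussian.
Context {R : realType}.

Definition cons_cv n (p : measurableTypeR R * 'cV[R]_n) : 'cV[R]_n.+1 :=
  col_mx (p.1)%:M p.2.

Lemma measurable_cons_cv n : measurable_fun setT (@cons_cv n).
Proof.
apply: measurable_fun_mx => i j; rewrite (ord1 j).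
case: (@split_ordP 1 n i) => k ->.
  have -> : (fun p => @cons_cv n p (lshift n k) 0) = fst.
    by apply/funext => p; rewrite [LHS]col_mxEu (ord1 k) mxE.
  exact: measurable_fst.
have -> : (fun p => @cons_cv n p (rshift 1 k) 0) = (fun p => p.2 k 0).
  by apply/funext => p; rewrite [LHS]col_mxEd.
exact: (measurableT_comp (measurable_coord k 0) measurable_snd).
Qed.

HB.instance Definition _ n :=
  isMeasurableFun.Build _ _ _ _ (@cons_cv n) (@measurable_cons_cv n).

(* The law N(0, I_n) of n independent standard normal coordinates. *)
Fixpoint std_gaussian n : probability 'cV[R]_n R :=
  if n is m.+1 then
    distribution (normal_prob (0 : R) 1 \x std_gaussian m)%E (@cons_cv m)
  else \d_(0 : 'cV[R]_0).

Definition mulmx_cv m n (A : 'M[R]_(m, n)) (v : 'cV[R]_n) : 'cV[R]_m := A *m v.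

Lemma measurable_mulmx_cv m n (A : 'M[R]_(m, n)) :
  measurable_fun setT (mulmx_cv A).
Proof. exact: measurable_fun_mulmx. Qed.

HB.instance Definition _ m n (A : 'M[R]_(m, n)) :=
  isMeasurableFun.Build _ _ _ _ (mulmx_cv A) (@measurable_mulmx_cv m n A).

(* N(0, C), the law of C^(1/2) Z for Z of law N(0, I_n); only meaningful when
   C is symmetric positive semidefinite. *)
Definition gaussian n (C : 'M[R]_n) : probability 'cV[R]_n R :=
  distribution (std_gaussian n) (mulmx_cv (sqrtmx C)).

Lemma measurable_gaussian n (B : set 'cV[R]_n) : measurable B ->
  measurable_fun setT (fun C : 'M[R]_n => gaussian C B).
Proof.
move=> mB.
pose E := (fun p : 'M[R]_n * 'cV[R]_n => sqrtmx p.1 *m p.2) @^-1` B.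
have mE : measurable E.
  rewrite /E -[X in measurable X]setTI.
  have : measurable_fun setT
      (fun p : 'M[R]_n * 'cV[R]_n => sqrtmx p.1 *m p.2).
    apply: measurable_fun_mulmx; last exact: measurable_snd.
    exact: (measurableT_comp (@measurable_sqrtmx R n) measurable_fst).
  by apply.
have -> : (fun C => gaussian C B) = std_gaussian n \o xsection E.
  apply/funext => C /=; rewrite /gaussian /distribution /pushforward/=.
  by congr (std_gaussian n _); apply/seteqP; split => v /=; rewrite /xsection/= inE.
exact: measurable_fun_xsection.
Qed.

End gaussian.

Section hierarchical.
Context {R : realType} d (Theta : measurableType d).
Variables (mu' : probability Theta R) (n : nat).
Variable C : {mfun Theta >-> 'M[R]_n}.
Local Open Scope ereal_scope.

Definition hierarchical (B : set 'cV[R]_n) : \bar R :=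
  \int[mu']_theta gaussian (C theta) B.

Let mgauss B : measurable B ->
  measurable_fun setT (fun theta => gaussian (C theta) B).
Proof.
move=> mB; apply: (measurableT_comp (measurable_gaussian mB)).
exact: measurable_funPT.
Qed.

Let hierarchical0 : hierarchical set0 = 0.
Proof. by rewrite /hierarchical integral0_eq. Qed.

Let hierarchical_ge0 B : 0 <= hierarchical B.
Proof. exact: integral_ge0. Qed.

Let hierarchical_sigma_additive : semi_sigma_additive hierarchical.
Proof.
move=> F mF tF mUF; rewrite [X in _ --> X](_ : _ =
    \int[mu']_theta \sum_(0 <= k <oo) gaussian (C theta) (F k)); last first.
  apply: eq_integral => theta _.
  by apply/esym/cvg_lim => //; exact: measure_sigma_additive.
rewrite integral_nneseries//; last by move=> k; exact: mgauss.
by apply: is_cvg_ereal_nneg_natsum => k _; exact: integral_ge0.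
Qed.

HB.instance Definition _ := isMeasure.Build _ _ _ hierarchical
  hierarchical0 hierarchical_ge0 hierarchical_sigma_additive.

Let hierarchicalT : hierarchical setT = 1.
Proof.
rewrite /hierarchical; under eq_integral do rewrite probability_setT.
rewrite integral_cst// mul1e; exact: probability_setT.
Qed.

HB.instance Definition _ :=
  Measure_isProbability.Build _ _ _ hierarchical hierarchicalT.

End hierarchical.

Section wasserstein.
Context {R : realType}.
Local Open Scope ereal_scope.

(* The Euclidean norm; the library's norm on matrices is the sup norm. *)
Definition norm2 n (x : 'cV[R]_n) : R := Num.sqrt (\sum_i x i 0 ^+ 2)%R.

(* R^(2n) is read as 'cV_(n + n), with the two projections to R^n given by the
   upper and the lower half. *)
Definition Coup n (nu nuhat : probability 'cV[R]_n R) :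
    set (probability 'cV[R]_(n + n) R) :=
  [set H | forall B : set 'cV[R]_n, measurable B ->
    H (usubmx @^-1` B) = nu B /\ H (dsubmx @^-1` B) = nuhat B].

Definition W2 n (nu nuhat : probability 'cV[R]_n R) : \bar R :=
  sqrte (ereal_inf
    [set \int[H]_X ((norm2 (usubmx X - dsubmx X) ^+ 2)%R)%:E
      | H in Coup nu nuhat]).

End wasserstein.

(* Main.v *)
Require Import Defs.
From HB Require Import structures.
From mathcomp Require Import all_boot all_order all_algebra.
From mathcomp Require Import all_classical all_reals all_analysis.
From mathcomp Require Import measurable_realfun ring lra.

Set Implicit Arguments.
Unset Strict Implicit.
Unset Printing Implicit Defensive.

Import Order.TTheory GRing.Theory Num.Theory.
Import numFieldNormedType.Exports.

Local Open Scope classical_set_scope.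
Local Open Scope ring_scope.

(** Both hierarchical measures are driven by the same standard Gaussian vector:
take theta of law mu' and Z of law N(0, I_n), independent, and put
X1 = C(theta)^(1/2) Z and X2 = Chat(theta)^(1/2) Z.  The law of (X1, X2) is a
coupling of the two measures ([sqrt_coupling_Coup]), and conditionally on theta
the expected cost E|X1 - X2|^2 is the trace of (A - B)^2, where A and B are the
square roots of C(theta) and Chat(theta) ([sqrt_coupling_cost]).

It remains to see that tr (A - B)^2 <= tr (A^2 - B^2) whenever A^2 - B^2 is
positive semidefinite ([mxtrace_sqrtmx_sub_le]).  The difference of the two
sides is 2 tr (B (A - B)), and A - B is positive semidefinite because the
square root is operator monotone ([SPSD_sqr_le]); the trace of a product of two
positive semidefinite matrices is nonnegative.

Two supporting facts take most of the work.
- Every positive semidefinite matrix has a positive semidefinite square root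
  ([exists_SPSD_sqrt]), so that [sqrtmx] takes no default value on them.
  Eigenvectors come from minimizing the quadratic form on the unit sphere, and
  the root is assembled by removing one eigenvector at a time.
- The second moment of an affine image a + M Z of a standard Gaussian vector is
  at most |a|^2 + tr (M^T M) ([integral_sqr_norm2_std_gaussian_le]).  Keeping
  the shift a lets an induction on the dimension absorb the coordinates one by
  one; each step integrates a nonnegative quadratic polynomial against N(0, 1)
  ([integral_quad_std_normal_le]), so that neither integrability nor cross
  moments E[Z_i Z_j] have to be discussed.  The upper bound suffices, since the
  coupling only bounds the distance from above. *)

(** * Square roots of positive semidefinite matrices *)

Section sqrt.
Context {R : realType}.

Lemma SPSD_D n (A B : 'M[R]_n) : SPSD A -> SPSD B -> SPSD (A + B).
Proof.
move=> [At A0] [Bt B0]; split=> [|x]; first by rewrite linearD/= At Bt.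
by rewrite mulmxDr mulmxDl mxE addr_ge0.
Qed.

Lemma SPSD_outer n (c : R) (v : 'cV[R]_n) : 0 <= c -> SPSD (c *: (v *m v^T)).
Proof.
move=> c0; split=> [|x]; first by rewrite linearZ/= trmx_mul trmxK.
rewrite -scalemxAr -scalemxAl mxE mulr_ge0//.
have xv : x^T *m v = (v^T *m x)^T by rewrite trmx_mul trmxK.
by rewrite mulmxA -(mulmxA (x^T *m v)) xv mulmx_tr_col_ge0.
Qed.

Lemma compact_unit_sphere n : compact [set v : 'rV[R]_n | (v *m v^T) 0 0 = 1].
Proof.
apply: bounded_closed_compact.
  exists 1; split => // M M1 v /= v1; apply/ltW; apply: le_lt_trans M1.
  rewrite [leLHS]/Num.norm/= mx_normrE; apply/bigmax_leP; split => // -[i j] _ /=.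
  rewrite (ord1 i) -sqrtr_sqr -sqrtr1 ler_sqrt// -v1 mxE (bigD1 j)//= mxE expr2.
  by rewrite lerDl sumr_ge0// => k _; rewrite mxE -expr2 sqr_ge0.
apply: (@closed_comp _ _ (fun v : 'rV[R]_n => (v *m v^T) 0 0) [set 1]).
  move=> v _; apply: (@continuous_comp _ _ _ (fun v : 'rV[R]_n => v *m v^T)
    (fun B : 'M[R]_1 => B 0 0)); last exact: coord_continuous.
  apply: continuous_mulmx => // w; first exact: cvg_id.
  apply: continuous_mx => i j; under eq_fun do rewrite mxE.
  exact: coord_continuous.
exact: closed_eq.
Qed.

(** The minimum l of the quadratic form of D on the unit sphere is attained at
some v.  Then D - l I is positive semidefinite by homogeneity, and its form
vanishes at v, which forces (D - l I) v = 0.  Semidefiniteness of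
D - l I is kept because it makes l the least eigenvalue, whose sign decides
whether D is positive semidefinite. *)
Lemma symmetric_min_eigenvector n (D : 'M[R]_n.+1) : D^T = D ->
  exists (l : R) (v : 'cV[R]_n.+1),
    [/\ (v^T *m v) 0 0 = 1, D *m v = l *: v & SPSD (D - l%:M)].
Proof.
move=> Dt.
have [||v] := @EVT_min_rV R n.+1 (fun v => (v *m D *m v^T) 0 0) _ _
    (@compact_unit_sphere n.+1).
- exists (delta_mx 0 0) => /=.
  by rewrite trmx_delta mul_delta_mx mxE eqxx.
- apply: continuous_subspaceT => v.
  apply: (@continuous_comp _ _ _ (fun v : 'rV[R]_n.+1 => v *m D *m v^T)
    (fun B : 'M[R]_1 => B 0 0)); last exact: coord_continuous.
  apply: continuous_mulmx => // w.
    by apply: continuous_mulmx => // u; [exact: cvg_id|exact: cst_continuous].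
  apply: continuous_mx => i j; under eq_fun do rewrite mxE.
  exact: coord_continuous.
rewrite inE/= => v1; set l := (v *m D *m v^T) 0 0 => vmin.
have sD : SPSD (D - l%:M).
  split=> [|x]; first by rewrite linearB/= Dt tr_scalar_mx.
  rewrite mulmxBr mulmxBl mxE [X in _ + X]mxE.
  rewrite mul_mx_scalar -scalemxAl [X in _ - X]mxE.
  have := mulmx_tr_col_ge0 x; rewrite le_eqVlt => /orP[/eqP x0|x0].
    have -> : x = 0 by apply: mulmx_tr_col_eq0; rewrite -x0.
    by rewrite !mulmx0 !mxE mulr0 subr0.
  set q := (x^T *m x) 0 0 in x0 *.
  pose s := Num.sqrt q.
  have s0 : 0 < s by rewrite sqrtr_gt0.
  have sq : s ^+ 2 = q by rewrite sqr_sqrtr// ltW.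
  have sxT : (s^-1 *: x^T)^T = s^-1 *: x by rewrite linearZ/= trmxK.
  have := vmin (s^-1 *: x^T); rewrite inE/= sxT.
  rewrite -!scalemxAr -!scalemxAl scalerA.
  rewrite [X in X = _ -> _]mxE -/q -invfM -expr2 sq mulVf ?gt_eqF// => /(_ erefl).
  rewrite scalerA [X in _ <= X]mxE -invfM -expr2 sq mulrC.
  by rewrite ler_pdivlMr// subr_ge0.
exists l, v^T; split => //; first by rewrite trmxK.
apply/eqP; rewrite -subr_eq0 -mul_scalar_mx -mulmxBl; apply/eqP.
apply: SPSD_quad_eq0 => //.
rewrite trmxK mulmxBr mulmxBl mxE -/l mul_mx_scalar -scalemxAl 2!mxE.
by rewrite v1 mulr1 subrr.
Qed.

(** Induction on the rank.  If v is a unit eigenvector of A for an eigenvalue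
m > 0, then A' = A - m v v^T is positive semidefinite, of smaller rank, and
kills v.  A square root S of A' kills v as well, hence S and v v^T annihilate
each other and S + sqrt(m) v v^T is a square root of A. *)
Lemma exists_SPSD_sqrt n (A : 'M[R]_n) :
  SPSD A -> exists2 S, SPSD S & S *m S = A.
Proof.
have [r] := ubnP (\rank A); elim: r A => // r IH A rA sA.
have [->|A0] := eqVneq A 0.
  exists 0; last by rewrite mulmx0.
  by split=> [|x]; rewrite ?trmx0// mulmx0 mul0mx mxE.
case: n A {IH} (IH) rA sA A0 => [|n] A IH rA sA A0.
  by case/eqP: A0; apply/matrixP => -[].
(* The least eigenvalue of - A is minus the greatest eigenvalue of A. *)
have [|l [v [v1 Av sl]]] := @symmetric_min_eigenvector n (- A).
  by rewrite linearN/= sA.1.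
set m := - l.
have {}Av : A *m v = m *: v by rewrite /m scaleNr -Av mulNmx opprK.
have m0 : 0 <= m.
  by have := sA.2 v; rewrite -mulmxA Av -scalemxAr mxE v1 mulr1.
(* If the greatest eigenvalue is 0, then - A is positive semidefinite too, so
   the form of A vanishes identically and A = 0. *)
have {m0} m0 : 0 < m.
  rewrite lt_neqAle m0 andbT; apply/eqP => mE.
  case/eqP: A0; apply/matrixP => i j.
  suff /matrixP/(_ i 0) : A *m delta_mx j 0 = 0 :> 'cV_n.+1.
    by rewrite -colE !mxE.
  apply: SPSD_quad_eq0 => //; apply/eqP; rewrite eq_le sA.2 andbT.
  have := sl.2 (delta_mx j 0).
  have -> : l = 0 by apply/eqP; rewrite -oppr_eq0 -/m -mE.
  rewrite -scalemx1 scale0r subr0.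
  by rewrite mulmxN mulNmx mxE oppr_ge0.
pose A' := A - m *: (v *m v^T).
have vvv : v *m (v^T *m v) = v.
  by rewrite [v^T *m v]mx11_scalar v1 mulmx1.
have A'v : A' *m v = 0.
  by rewrite mulmxBl Av -scalemxAl -mulmxA vvv subrr.
have A't : A'^T = A'.
  by rewrite linearB/= linearZ/= trmx_mul trmxK sA.1.
have vA' : v^T *m A' = 0 by rewrite -[A']A't -trmx_mul A'v trmx0.
have sA' : SPSD A'.
  split => // x.
  (* y is the component of x orthogonal to v; A and A' agree there, and A'
     does not see the component along v. *)
  pose y := x - v *m (v^T *m x).
  have A'y : A' *m y = A' *m x by rewrite mulmxBr (mulmxA A') A'v mul0mx subr0.
  have vy : v^T *m y = 0.
    by rewrite mulmxBr (mulmxA v^T) [v^T *m v]mx11_scalar v1 mul1mx subrr.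
  have -> : x^T *m A' *m x = y^T *m A *m y.
    transitivity (y^T *m A' *m y).
      have yA' : y^T *m A' = x^T *m A' by rewrite -[A']A't -!trmx_mul A'y.
      by rewrite yA' -!mulmxA A'y.
    have Ay : A' *m y = A *m y.
      by rewrite mulmxBl -scalemxAl -(mulmxA v) vy mulmx0 scaler0 subr0.
    by rewrite -(mulmxA _ A') Ay mulmxA.
  exact: sA.2.
(* A' = A - v (v^T A) has its row space inside that of A; the row v^T lies in
   the latter but not in the former, since A' v = 0 while v^T v = 1. *)
have rk : (\rank A' < \rank A)%N.
  have vA : (v^T <= A)%MS.
    have mvT : m *: v^T = v^T *m A by rewrite -sA.1 -trmx_mul Av linearZ.
    by rewrite -[v^T](scalerK (lt0r_neq0 m0)) mvT scalemxAl submxMl.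
  apply: rank_ltmx; rewrite /ltmx addmx_sub ?submx_refl//=; last first.
    by rewrite eqmx_opp scalemx_sub// mulmx_sub.
  apply/negP => AA'; have /submxP[w wE] := submx_trans vA AA'.
  have := v1; rewrite wE -mulmxA A'v mulmx0 mxE => /eqP.
  by rewrite eq_sym oner_eq0.
have [|S sS SS] := IH A' _ sA'; first exact: leq_trans rk _.
have Sv : S *m v = 0.
  apply: mulmx_tr_col_eq0.
  by rewrite trmx_mul sS.1 mulmxA -[v^T *m S *m S]mulmxA SS vA' mul0mx mxE.
have vS : v^T *m S = 0 by rewrite -[S]sS.1 -trmx_mul Sv trmx0.
exists (S + Num.sqrt m *: (v *m v^T)).
  by apply: SPSD_D => //; apply: SPSD_outer; exact: sqrtr_ge0.
rewrite mulmxDl !mulmxDr -!scalemxAl -!scalemxAr SS [S *m (v *m _)]mulmxA Sv.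
rewrite -[v *m v^T *m S]mulmxA vS mulmx0 mul0mx !scaler0 addr0 add0r.
rewrite scalerA -expr2 sqr_sqrtr ?ltW//.
by rewrite mulmxA -[v *m v^T *m v]mulmxA vvv subrK.
Qed.

Lemma SPSD_sqrtmx n (A : 'M[R]_n) : SPSD A ->
  SPSD (sqrtmx A) /\ sqrtmx A *m sqrtmx A = A.
Proof. by case/exists_SPSD_sqrt => S sS <-; rewrite sqrtmxE. Qed.

(** Operator monotonicity of the square root.  Let l be the least eigenvalue of
D = A - B, with unit eigenvector v.  As A^2 - B^2 = A D + D B, its quadratic
form at v is l (v^T A v + v^T B v).  If l < 0, both terms must vanish, so that
A v = B v = 0 and l v = D v = 0, which is absurd. *)
Lemma SPSD_sqr_le n (A B : 'M[R]_n) : SPSD A -> SPSD B ->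
  SPSD (A *m A - B *m B) -> SPSD (A - B).
Proof.
case: n A B => [|n] A B sA sB sAB.
  by have -> : A - B = A by apply/matrixP => -[].
have Dt : (A - B)^T = A - B by rewrite linearB/= sA.1 sB.1.
have [l [v [v1 Dv sl]]] := symmetric_min_eigenvector Dt.
have [l0|l0] := leP 0 l.
  split => // x; have := sl.2 x.
  rewrite mulmxBr mulmxBl mxE [X in _ + X]mxE.
  rewrite mul_mx_scalar -scalemxAl [X in _ - X]mxE subr_ge0; apply: le_trans.
  by rewrite mulr_ge0// mulmx_tr_col_ge0.
have vD : v^T *m (A - B) = l *: v^T by rewrite -Dt -trmx_mul Dv linearZ.
have E : A *m A - B *m B = A *m (A - B) + (A - B) *m B.
  by rewrite mulmxBr mulmxBl addrA subrK.
have := sAB.2 v; rewrite E mulmxDr mulmxDl -mulmxA -[A *m _ *m v]mulmxA Dv.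
rewrite [v^T *m (_ *m B)]mulmxA vD -!scalemxAr -!scalemxAl mulmxA.
rewrite mxE [X in X + _]mxE [X in _ + X]mxE -mulrDr.
have a0 := sA.2 v; have b0 := sB.2 v.
rewrite nmulr_rge0// => ab.
have Av : A *m v = 0 by apply: SPSD_quad_eq0 => //; lra.
have Bv : B *m v = 0 by apply: SPSD_quad_eq0 => //; lra.
have := congr1 (fun w => (v^T *m w) 0 0) Dv.
rewrite mulmxBl Av Bv subrr mulmx0 -scalemxAr !mxE.
rewrite mxE in v1; rewrite v1 mulr1 => l00.
by rewrite -l00 ltxx in l0.
Qed.

(** With A = S^2, cyclicity gives tr (A B) = tr (S B S), and S B S is positive
semidefinite. *)
Lemma mxtrace_mul_SPSD_ge0 n (A B : 'M[R]_n) :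
  SPSD A -> SPSD B -> 0 <= \tr (A *m B).
Proof.
move=> sA sB; have [S sS <-] := exists_SPSD_sqrt sA.
rewrite mxtrace_mulC mulmxA mxtrace_mulC mulmxA.
exact: (SPSD_tr_eq0 sB sS.1).1.
Qed.

(** Writing A and B for the two square roots, the right-hand side minus the
left-hand side is 2 tr (B (A - B)). *)
Lemma mxtrace_sqrtmx_sub_le n (C D : 'M[R]_n) :
  SPSD C -> SPSD D -> SPSD (C - D) ->
  \tr ((sqrtmx C - sqrtmx D)^T *m (sqrtmx C - sqrtmx D)) <= \tr (C - D).
Proof.
move=> sC sD sCD.
have [sA AC] := SPSD_sqrtmx sC; have [sB BD] := SPSD_sqrtmx sD.
set A := sqrtmx C in sA AC *; set B := sqrtmx D in sB BD *.
have sAB : SPSD (A - B) by apply: SPSD_sqr_le => //; rewrite AC BD.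
have := mxtrace_mul_SPSD_ge0 sB sAB.
rewrite sAB.1 -AC -BD !mulmxBl !mulmxBr !raddfB/= [\tr (A *m B)]mxtrace_mulC; lra.
Qed.

End sqrt.

(** * Quadratic polynomials under the standard normal law *)

Section normal_moment.
Context {R : realType}.
Local Notation mu := (@lebesgue_measure R).
Local Notation phi := (normal_pdf (0 : R) 1).

Lemma is_derive_std_normal_pdf (x : R) : is_derive x 1 phi (- x * phi x).
Proof.
rewrite normal_pdfE ?oner_eq0//.
have -> : (fun x => normal_peak 1 * normal_fun 0 1 x) =
    normal_peak 1 *: (expR \o (fun y : R => - 2^-1 * y ^+ 2)) :> (R -> R).
  apply/funext => y; rewrite /normal_fun/= subr0 expr1n.
  by rewrite -[LHS]/(normal_peak 1 *: _); congr (_ *: expR _); field.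
apply: is_derive_eq.
rewrite /= /normal_fun subr0 expr1n.
have -> : - x ^+ 2 / (1 *+ 2) = - 2^-1 * x ^+ 2 by field.
rewrite /GRing.scale/=.
by field.
Qed.

Lemma continuous_std_normal_pdf : continuous phi.
Proof. by apply: continuous_normal_pdf; exact: oner_neq0. Qed.

(** The Radon-Nikodym derivative of N(0, 1) is almost everywhere its density.
The integrand only has to be integrable, which on a compact interval follows
from continuity. *)
Lemma integral_std_normal_prob_itv (q : R -> R) (a b : R) : continuous q ->
  (\int[normal_prob 0%R 1%R]_(x in `[a, b]) (q x)%:E =
   \int[mu]_(x in `[a, b]) (q x * phi x)%:E)%E.
Proof.
move=> cq.
have mq D : measurable D -> measurable_fun D (EFin \o q).
  move=> mD; apply/measurable_EFinP; apply: measurable_funTS.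
  exact: continuous_measurable_fun.
have mphi D : measurable_fun D (fun x => (phi x)%:E).
  by apply/measurable_EFinP/measurable_funTS; exact: measurable_normal_pdf.
rewrite -(Radon_Nikodym_change_of_variables (normal_prob_dominates 0 1))//=; last first.
  apply: measurable_bounded_integrable => //.
  - by rewrite (le_lt_trans (probability_le1 _ _)) ?ltry.
  - by apply: measurable_funTS; exact: continuous_measurable_fun.
  - have [M [_ mrt]] : bounded_set (q @` `[a, b]).
      apply: compact_bounded; apply: continuous_compact; last exact: segment_compact.
      exact: continuous_subspaceT.
    by exists M; split; rewrite ?num_real // => ? ? ? ?; exact: mrt.
under [RHS]eq_integral do rewrite EFinM.
apply: ae_eq_integral => //.
- apply: emeasurable_funM => //; first exact: mq.
  apply: (measurable_int mu).
  apply: (integrableS _ _ (@subsetT _ _)) => //=.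
  by apply: Radon_Nikodym_integrable; exact: normal_prob_dominates.
- by apply: emeasurable_funM; [exact: mq|exact: mphi].
- apply: ae_eqe_mul2l => /=.
  rewrite Radon_NikodymE//=; first exact: normal_prob_dominates.
  move=> Nmu; case: cid => /= h [h1 h2 h3].
  apply: integral_ae_eq => //=.
  + exact: integrableS h2.
  + exact: mphi.
  + by move=> E _ mE; rewrite -h3.
Qed.

(** The derivative of (beta + gamma x) phi(x) is (alpha + gamma - q(x)) phi(x),
where q is the polynomial.  Hence on [-b, b] the integral of q phi is
alpha + gamma times the mass of the interval, minus the boundary term
2 gamma b phi(b) >= 0; then let b tend to infinity, using q >= 0. *)
Lemma integral_quad_std_normal_le (alpha beta gamma : R) :
    0 <= gamma -> (forall x, 0 <= alpha + beta * x + gamma * x ^+ 2) ->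
  (\int[normal_prob 0%R 1%R]_x (alpha + beta * x + gamma * x ^+ 2)%:E
    <= (alpha + gamma)%:E)%E.
Proof.
move=> gamma0; set q := (fun x : R => alpha + beta * x + gamma * x ^+ 2) => q0.
have cq : continuous q.
  move=> x; apply: cvgD; first by apply: cvgD; [exact: cvg_cst|exact: cvgMr].
  by apply: cvgM; [exact: cvg_cst|exact: exprn_continuous].
pose F x := (beta + gamma * x) * phi x.
pose f x := (alpha + gamma - q x) * phi x.
have dF (x : R) : is_derive x 1 F (f x).
  have dphi := is_derive_std_normal_pdf x.
  have -> : F = (cst beta + gamma *: id) * phi :> (R -> R) by [].
  apply: is_derive_eq; rewrite /f /q /GRing.scale/= add0r.
  rewrite -[(cst beta + _) x]/(beta + gamma * x).
  ring.
have cf : continuous f.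
  move=> x; apply: cvgM; last exact: continuous_std_normal_pdf.
  by apply: cvgB; [exact: cvg_cst|exact: cq].
have cqphi : continuous (fun x => q x * phi x).
  by move=> x; apply: cvgM; [exact: cq|exact: continuous_std_normal_pdf].
have intc (g : R -> R) (a b : R) : continuous g -> mu.-integrable `[a, b] (EFin \o g).
  move=> cg; apply: continuous_compact_integrable; first exact: segment_compact.
  exact: continuous_subspaceT.
have itv_le (b : R) : 0 < b ->
    (\int[normal_prob 0%R 1%R]_(x in `[(- b)%R, b]) (q x)%:E <= (alpha + gamma)%:E)%E.
  move=> b0; rewrite integral_std_normal_prob_itv//.
  have If : (\int[mu]_(x in `[(- b)%R, b]) (f x)%:E = (2 * gamma * b * phi b)%:E)%E.
    rewrite (@continuous_FTC2 _ f F).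
    - rewrite -EFinB; congr EFin.
      have -> : F (- b) = (beta - gamma * b) * phi b.
        by rewrite /F mulrN normal_pdfE ?oner_neq0// /normal_fun !subr0 sqrrN.
      by rewrite /F; ring.
    - by rewrite gtrN.
    - exact: continuous_subspaceT.
    - have cF : continuous F.
        by move=> x; apply/differentiable_continuous/derivable1_diffP.
      split.
      + by move=> x _; exact: ex_derive.
      + exact/cvg_at_right_filter/cF.
      + exact/cvg_at_left_filter/cF.
    - by move=> x _; rewrite derive1E derive_val.
  apply: (@le_trans _ _ (\int[mu]_(x in `[(- b)%R, b]) (q x * phi x)%:E +
      \int[mu]_(x in `[(- b)%R, b]) (f x)%:E)%E).
    rewrite leeDl// If lee_fin mulr_ge0 ?normal_pdf_ge0//.
    by rewrite mulr_ge0 ?mulr_ge0// ltW.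
  rewrite -integralD//=; [|exact: (intc (fun x => q x * phi x))|exact: intc].
  under eq_integral.
    move=> x _; rewrite -EFinD.
    have -> : q x * phi x + f x = (alpha + gamma) * phi x by rewrite /f; ring.
    rewrite EFinM; over.
  rewrite integralZl//; last first.
    apply: (integrableS measurableT) => //; exact: integrable_normal_pdf.
  rewrite -[leRHS]mule1; apply: lee_wpmul2l.
    (* alpha = q(0) >= 0 *)
    by rewrite lee_fin addr_ge0//; have := q0 0; rewrite /q mulr0 expr0n mulr0 !addr0.
  exact: (probability_le1 (normal_prob 0%R 1%R)).
pose I (i : nat) : set (measurableTypeR R) := `[- i.+1%:R, i.+1%:R]%classic.
have IT : \bigcup_i I i = setT.
  apply/seteqP; split => // x _; exists (Num.truncn `|x|) => //=.
  by rewrite /I/= in_itv/= -ler_norml ltW// truncnS_gt.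
have cvgI : (\int[normal_prob 0%R 1%R]_(x in I i) (q x)%:E @[i --> \oo] -->
    \int[normal_prob 0%R 1%R]_x (q x)%:E)%E.
  rewrite -IT; apply: ge0_nondecreasing_set_cvg_integral.
  - move=> i j ij; rewrite subsetEset; apply: subset_itv.
      by rewrite bnd_simp lerN2 ler_nat.
    by rewrite bnd_simp ler_nat.
  - by move=> i; exact: measurable_itv.
  - move=> i; apply/measurable_EFinP; apply: measurable_funTS.
    exact: continuous_measurable_fun.
  - by move=> i x _; rewrite lee_fin; exact: q0.
by apply: (cvge_to_le cvgI); near=> i; exact: itv_le.
Unshelve. all: by end_near.
Qed.

End normal_moment.

(** * Second moments of the standard Gaussian vector *)

Section gaussian_moment.
Context {R : realType}.

Lemma measurable_sqr_norm2 d (T : measurableType d) n (f : T -> 'cV[R]_n) :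
  measurable_fun setT f -> measurable_fun setT (fun x => norm2 (f x) ^+ 2).
Proof.
move=> mf; apply: measurable_funX.
apply: (measurableT_comp (continuous_measurable_fun (@sqrt_continuous R))).
apply: measurable_sum => i; apply: measurable_funX.
exact: (measurableT_comp (measurable_coord i 0) mf).
Qed.

Lemma sqr_norm2 n (x : 'cV[R]_n) : norm2 x ^+ 2 = \sum_i x i 0 ^+ 2.
Proof. by rewrite sqr_sqrtr// sumr_ge0// => i _; exact: sqr_ge0. Qed.

Lemma measurable_sqr_norm2_affine m n (b : 'cV[R]_m) (N : 'M[R]_(m, n)) :
  measurable_fun setT (fun z : 'cV[R]_n => (norm2 (b + N *m z) ^+ 2)%:E).
Proof.
apply/measurable_EFinP/measurable_sqr_norm2; apply: measurable_fun_mx => i j.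
under eq_fun do rewrite mxE; apply: measurable_funD; first exact: measurable_cst.
exact: (measurableT_comp (measurable_coord i j) (measurable_mulmx_cv N)).
Qed.

Lemma mxtrace_gram_ge0 m n (M : 'M[R]_(m, n)) : 0 <= \tr (M^T *m M).
Proof.
apply: sumr_ge0 => i _; rewrite mxE sumr_ge0// => k _.
by rewrite mxE -expr2 sqr_ge0.
Qed.

Lemma SPSD_mxtrace_ge0 n (A : 'M[R]_n) : SPSD A -> 0 <= \tr A.
Proof.
by case/exists_SPSD_sqrt => S sS <-; have := mxtrace_gram_ge0 S; rewrite sS.1.
Qed.

(** Induction on n.  Let c be the first column of M, M' the rest, and split
Z = (x, z).  Then a + M Z = (a + x c) + M' z; for fixed x, the induction
hypothesis bounds the integral over z by |a + x c|^2 + tr (M'^T M'), which is a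
nonnegative quadratic polynomial in x whose coefficient of x^2 is |c|^2. *)
Lemma integral_sqr_norm2_std_gaussian_le m n (a : 'cV[R]_m) (M : 'M[R]_(m, n)) :
  (\int[std_gaussian n]_z (norm2 (a + M *m z) ^+ 2)%:E <=
   (norm2 a ^+ 2 + \tr (M^T *m M))%:E)%E.
Proof.
elim: n a M => [|n IH] a M.
  rewrite integral_dirac//=; last first.
    exact: measurable_sqr_norm2_affine.
  rewrite diracT mul1e mulmx0 addr0 lee_fin lerDl.
  by rewrite /mxtrace big_ord0.
pose c := lsubmx (M : 'M[R]_(m, 1 + n)); pose M' := rsubmx (M : 'M[R]_(m, 1 + n)).
have ME x z : M *m cons_cv (x, z) = x *: c + M' *m z.
  rewrite -[M in LHS](@hsubmxK _ m 1 n).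
  by rewrite [LHS](@mul_row_col R m 1 n 1 c M' x%:M z) mul_mx_scalar.
rewrite /= ge0_integral_distribution//=; last 2 first.
- exact: measurable_sqr_norm2_affine.
- by move=> z; rewrite lee_fin sqr_ge0.
have mcons : measurable_fun setT
    (fun p : measurableTypeR R * 'cV[R]_n =>
       (norm2 (a + M *m cons_cv p) ^+ 2)%:E).
  exact: (measurableT_comp (measurable_sqr_norm2_affine a M)
    (@measurable_cons_cv R n)).
rewrite fubini_tonelli1//=; last first.
  by move=> z; rewrite lee_fin sqr_ge0.
pose t := \tr (M'^T *m M').
pose beta := 2 * \sum_i a i 0 * c i 0.
have cE x : norm2 (a + x *: c) ^+ 2 + t =
    (norm2 a ^+ 2 + t) + beta * x + norm2 c ^+ 2 * x ^+ 2.
  rewrite !sqr_norm2.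
  have -> : \sum_i (a + x *: c) i 0 ^+ 2 = \sum_i a i 0 ^+ 2 + beta * x +
      (\sum_i c i 0 ^+ 2) * x ^+ 2.
    rewrite /beta mulr_sumr !mulr_suml -!big_split/=; apply: eq_bigr => i _.
    by rewrite !mxE; ring.
  by ring.
have -> : norm2 a ^+ 2 + \tr (M^T *m M) = (norm2 a ^+ 2 + t) + norm2 c ^+ 2.
  have -> : \tr (M^T *m M) = \tr (c^T *m c) + t.
    rewrite -[M](@hsubmxK _ m 1 n) (@tr_row_mx R m 1 n c).
    by rewrite [X in \tr X](@mul_col_row R 1 n m 1 n) (@mxtrace_block R 1 n).
  by rewrite trace_mx11 mulmx_tr_col -sqr_norm2 addrAC addrA.
apply: le_trans; last first.
  apply: (@integral_quad_std_normal_le R _ beta); first exact: sqr_ge0.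
  move=> x; rewrite -cE addr_ge0 ?sqr_ge0//.
  exact: mxtrace_gram_ge0.
apply: ge0_le_integral => //=.
- by move=> x _; apply: integral_ge0 => z _; rewrite lee_fin sqr_ge0.
- apply: measurable_fun_fubini_tonelli_F => // z.
  by rewrite lee_fin sqr_ge0.
- apply/measurable_EFinP; apply: measurable_funD.
    by apply: measurable_funD => //; apply: measurable_funM.
  by apply: measurable_funM => //; apply: measurable_funX.
move=> x _; rewrite -cE /fubini_F /=.
under eq_integral do rewrite ME addrA.
exact: IH.
Qed.

End gaussian_moment.

(** * The coupling through a common Gaussian vector *)

Section coupling.
Context {R : realType}.

Lemma measurable_col_mx d (T : measurableType d) m n
    (f : T -> 'cV[R]_m) (g : T -> 'cV[R]_n) :
  measurable_fun setT f -> measurable_fun setT g ->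
  measurable_fun setT (fun x => col_mx (f x) (g x)).
Proof.
move=> mf mg; apply: measurable_fun_mx => i j; rewrite (ord1 j).
case: (split_ordP i) => k ->.
  under eq_fun do rewrite col_mxEu.
  exact: (measurableT_comp (measurable_coord k 0) mf).
under eq_fun do rewrite col_mxEd.
exact: (measurableT_comp (measurable_coord k 0) mg).
Qed.

Context d (Theta : measurableType d) (mu' : probability Theta R) (n : nat).

Definition sqrt_map (C : Theta -> 'M[R]_n) (p : Theta * 'cV[R]_n) : 'cV[R]_n :=
  sqrtmx (C p.1) *m p.2.

Lemma measurable_sqrt_map (C : {mfun Theta >-> 'M[R]_n}) :
  measurable_fun setT (sqrt_map C).
Proof.
apply: measurable_fun_mulmx; last exact: measurable_snd.
apply: (measurableT_comp (@measurable_sqrtmx R n)).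
by apply: measurableT_comp => //; exact: measurable_funPT.
Qed.

(** The hierarchical measure is the law of C(theta)^(1/2) Z under
mu' x N(0, I_n): sections of the preimage at theta are the events defining
N(0, C(theta)). *)
Lemma hierarchicalE (C : {mfun Theta >-> 'M[R]_n}) (B : set 'cV[R]_n) :
  hierarchical mu' C B = (mu' \x std_gaussian n)%E (sqrt_map C @^-1` B).
Proof.
apply: eq_integral => theta _; rewrite /gaussian /distribution /pushforward/=.
by congr (std_gaussian n _); apply/seteqP; split => v /=; rewrite /xsection/= inE.
Qed.

Variables C Chat : {mfun Theta >-> 'M[R]_n}.

Definition sqrt_coupling_map (p : Theta * 'cV[R]_n) : 'cV[R]_(n + n) :=
  col_mx (sqrt_map C p) (sqrt_map Chat p).

Lemma measurable_sqrt_coupling_map : measurable_fun setT sqrt_coupling_map.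
Proof. by apply: measurable_col_mx; exact: measurable_sqrt_map. Qed.

HB.instance Definition _ :=
  isMeasurableFun.Build _ _ _ _ sqrt_coupling_map measurable_sqrt_coupling_map.

Definition sqrt_coupling : probability 'cV[R]_(n + n) R :=
  distribution (mu' \x std_gaussian n)%E sqrt_coupling_map.

Lemma sqrt_coupling_Coup :
  Coup (hierarchical mu' C) (hierarchical mu' Chat) sqrt_coupling.
Proof.
move=> B mB; split; rewrite [RHS]hierarchicalE;
  apply: (congr1 (mu' \x std_gaussian n)%E);
  by apply/seteqP; split => p /=;
    rewrite /preimage/= /sqrt_coupling_map ?col_mxKu ?col_mxKd.
Qed.

Lemma measurable_sqrt_cost : measurable_fun setT (fun theta =>
  (\tr ((sqrtmx (C theta) - sqrtmx (Chat theta))^T *m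
        (sqrtmx (C theta) - sqrtmx (Chat theta))))%:E).
Proof.
have mS (D : {mfun Theta >-> 'M[R]_n}) k l :
    measurable_fun setT (fun theta => sqrtmx (D theta) k l).
  apply: (measurableT_comp (measurable_coord k l)).
  exact: (measurableT_comp (@measurable_sqrtmx R n) (measurable_funPT D)).
apply/measurable_EFinP; apply: measurable_sum => i.
apply: (measurableT_comp (measurable_coord i i)); apply: measurable_fun_mulmx;
  apply: measurable_fun_mx => k l; under eq_fun do rewrite !mxE;
  by apply: measurable_funB; exact: mS.
Qed.

(** For fixed theta, X1 - X2 is the image of Z under the difference of the two
square roots. *)
Lemma sqrt_coupling_cost :
  (\int[sqrt_coupling]_X (norm2 (usubmx X - dsubmx X) ^+ 2)%:E <=
   \int[mu']_theta
     (\tr ((sqrtmx (C theta) - sqrtmx (Chat theta))^T *m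
           (sqrtmx (C theta) - sqrtmx (Chat theta))))%:E)%E.
Proof.
have msub : measurable_fun setT (fun X : 'cV[R]_(n + n) => usubmx X - dsubmx X).
  apply: measurable_fun_mx => i j; under eq_fun do rewrite !mxE.
  by apply: measurable_funB; exact: measurable_coord.
have mcost : measurable_fun setT (fun X : 'cV[R]_(n + n) =>
    (norm2 (usubmx X - dsubmx X) ^+ 2)%:E).
  exact/measurable_EFinP/measurable_sqr_norm2.
rewrite ge0_integral_distribution//=; last first.
  by move=> X; rewrite lee_fin sqr_ge0.
have mcomp := measurableT_comp mcost measurable_sqrt_coupling_map.
rewrite fubini_tonelli1//=; last first.
  by move=> p; rewrite lee_fin sqr_ge0.
apply: ge0_le_integral => //=.
- by move=> theta _; apply: integral_ge0 => z _; rewrite lee_fin sqr_ge0.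
- apply: measurable_fun_fubini_tonelli_F => // p.
  by rewrite lee_fin sqr_ge0.
- exact: measurable_sqrt_cost.
move=> theta _; rewrite /fubini_F/=.
have := integral_sqr_norm2_std_gaussian_le 0
  (sqrtmx (C theta) - sqrtmx (Chat theta)).
rewrite sqr_norm2 big1 ?add0r; last by move=> i _; rewrite mxE expr0n.
apply: le_trans; rewrite le_eqVlt; apply/orP; left; apply/eqP.
apply: eq_integral => z _.
by rewrite add0r /sqrt_coupling_map col_mxKu col_mxKd mulmxBl.
Qed.

End coupling.

(** * The bound on the Wasserstein distance *)

Local Open Scope ereal_scope.

Theorem theorem2p6 (R : realType) (d : measure_display)
    (Theta : measurableType d) (mu' : probability Theta R) (n : nat)
    (C Chat : {mfun Theta >-> 'M[R]_n})
    (C_SPSD : forall theta, SPSD (C theta))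
    (Chat_SPSD : forall theta, SPSD (Chat theta))
    (C_Chat : {ae mu', forall theta, SPSD (C theta - Chat theta)%R})
    (C_moment2 :
      \int[hierarchical mu' C]_X ((norm2 X ^+ 2)%R)%:E < +oo) :
  W2 (hierarchical mu' C) (hierarchical mu' Chat) <=
  sqrte (\int[mu']_theta (\tr (C theta - Chat theta)%R)%:E).
Proof.
pose g theta := \tr (C theta - Chat theta)%R.
pose f theta := \tr ((sqrtmx (C theta) - sqrtmx (Chat theta))^T *m
  (sqrtmx (C theta) - sqrtmx (Chat theta)))%R.
have g0 theta : SPSD (C theta - Chat theta)%R -> (0 <= g theta)%R.
  exact: SPSD_mxtrace_ge0.
have mg : measurable_fun setT g.
  apply: measurable_sum => i; under eq_fun do rewrite !mxE.
  by apply: measurable_funB;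
    apply: (measurableT_comp (measurable_coord i i)); exact: measurable_funPT.
(* The trace of C - Chat may be negative on a null set of theta; truncating it
   there at 0 gives an integrand to which monotonicity applies. *)
have -> : \int[mu']_theta (g theta)%:E = \int[mu']_theta (Num.max (g theta) 0)%R%:E.
  apply: ae_eq_integral => //.
  - exact/measurable_EFinP.
  - exact/measurable_EFinP/measurable_maxr.
  - by apply: filterS C_Chat => theta /g0 gtheta0 _; rewrite max_l.
rewrite /W2 lee_sqrt; last first.
  by apply: integral_ge0 => theta _; rewrite lee_fin le_max lexx orbT.
apply: (@le_trans _ _ (\int[mu']_theta (f theta)%:E)).
  apply: le_trans (sqrt_coupling_cost mu' C Chat); apply: ereal_inf_lbound.
  by exists (sqrt_coupling mu' C Chat) => //; exact: sqrt_coupling_Coup.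
apply: ae_ge0_le_integral => //.
- by move=> theta _; rewrite lee_fin mxtrace_gram_ge0.
- exact: measurable_sqrt_cost.
- by move=> theta _; rewrite lee_fin le_max lexx orbT.
- exact/measurable_EFinP/measurable_maxr.
- apply: filterS C_Chat => theta sCC _; rewrite lee_fin le_max.
  by rewrite mxtrace_sqrtmx_sub_le.
Qed.
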